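(* Let $G$ be a discrete group. Let $\mathbb{L}:G\to[0,\infty)$ be a length function on $G$ that has bounded doubling, and let $D_{\mathbb{L}}$ be the associated Dirac operator (pointwise multiplication by $\mathbb{L}$). For every $\varepsilon>0$ there exists a finite set $S_\varepsilon\subset G$ such that for any finitely supported $f:G\to\mathbb{C}$ satisfying $\|[D_{\mathbb{L}},\lambda_f]\|\le 1$ there exists a decomposition $f=f_\sharp+f_\flat$ such that $f_\flat$ is supported on $S_\varepsilon$ and $\|\lambda_{f_\sharp}\|\le\varepsilon$.
   Context: A length function on a group $G$ with identity $e$ is a function $\mathbb{L}:G\to[0,\infty)$ with $\mathbb{L}(xy)\le \mathbb{L}(x)+\mathbb{L}(y)$, $\mathbb{L}(x^{-1})=\mathbb{L}(x)$, and $\mathbb{L}(x)=0$ if and only if $x=e$. Put $B(r)=\{x\in G:\mathbb{L}(x)\le r\}$. $\mathbb{L}$ has bounded doubling if $B(r)$ is finite for every $r<\infty$ and there is a constant $C_{\mathbb{L}}<\infty$ with $|B(2r)|\le C_{\mathbb{L}}|B(r)|$ for all $r\ge 1$. For finitely supported $f:G\to\mathbb{C}$, $\lambda_f$ is the bounded operator on $\ell^2(G)$ given by $(\lambda_f\xi)(x)=\sum_{y\in G}f(xy^{-1})\xi(y)$. The operator $D_{\mathbb{L}}$ is the (possibly unbounded) operator of pointwise multiplication by $\mathbb{L}$ on $\ell^2(G)$; the commutator $[D_{\mathbb{L}},\lambda_f]$ extends to a bounded operator on $\ell^2(G)$, and $\|\cdot\|$ is the operator norm. *)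

(* Defs.v *)
From HB Require Import structures.
From mathcomp Require Export all_boot all_order all_algebra.
From mathcomp Require Export finmap.
From mathcomp Require Export all_classical all_reals all_analysis.
From mathcomp Require Export complex.

Set Implicit Arguments.
Unset Strict Implicit.
Unset Printing Implicit Defensive.

Import Order.TTheory GRing.Theory Num.Theory.

Local Open Scope classical_set_scope.
Local Open Scope ring_scope.

(* In this file [G] is an arbitrary, possibly infinite, group, written
   multiplicatively, and the complex numbers are [R[i]] with [R : realType]. *)

Section LengthFunctions.
Variables (R : realType) (G : groupType).
Implicit Type L : G -> R.

Record is_length L : Prop := IsLength {
  length_ge0 : forall x, 0 <= L x ;
  length_mul : forall x y, L (x * y)%g <= L x + L y ;
  length_inv : forall x, L (x^-1)%g = L x ;
  length_eq0 : forall x, L x = 0 <-> x = 1%g }.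

Definition length_ball L (r : R) : set G := [set x | L x <= r].

Definition bounded_doubling L : Prop :=
  (forall r : R, finite_set (length_ball L r)) /\
  exists C : R, forall r : R, 1 <= r ->
    #|` fset_set (length_ball L (2 * r))|%:R
      <= C * #|` fset_set (length_ball L r)|%:R.

End LengthFunctions.

Section Operators.
Variables (R : realType) (G : groupType).
Implicit Types (f xi : G -> R[i]) (L : G -> R).

Definition supp f : set G := [set x | f x != 0].

Definition l2norm xi : \bar R :=
  sqrte (\esum_(x in [set: G]) (Normc.normc (xi x) ^+ 2)%:E).

Definition l2 : set (G -> R[i]) := [set xi | (l2norm xi < +oo)%E].

(* The norm of an operator [T] defined on the subspace [dom] of [l2].  When
   [dom] is dense and [T] is linear and bounded on [dom], this is also the
   norm of the unique bounded extension of [T] to [l2]. *)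
Definition opnorm (dom : set (G -> R[i])) (T : (G -> R[i]) -> (G -> R[i])) :
    \bar R :=
  ereal_sup [set l2norm (T xi) | xi in dom `&` [set xi | (l2norm xi <= 1)%E]].

(* For [f] of finite support, only finitely many terms of this sum are
   nonzero; for other [f] the value is irrelevant. *)
Definition lambda f xi : G -> R[i] :=
  fun x => \sum_(y \in [set: G]) f (x * y^-1)%g * xi y.

Definition Dirac L xi : G -> R[i] := fun x => (L x)%:C%C * xi x.

Definition Dirac_dom L : set (G -> R[i]) := l2 `&` [set xi | l2 (Dirac L xi)].

(* If [f] has finite support and [L] is a length function then [lambda f] maps
   [Dirac_dom L] to itself, so that [Dirac_dom L], which is dense in [l2], is
   the natural domain of this commutator. *)
Definition commutator L f xi : G -> R[i] :=
  fun x => Dirac L (lambda f xi) x - lambda f (Dirac L xi) x.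

Definition lambda_norm f : \bar R := opnorm l2 (lambda f).

Definition commutator_norm L f : \bar R :=
  opnorm (Dirac_dom L) (commutator L f).

End Operators.

(* Main.v *)
Require Import Defs.
From mathcomp Require Import ring lra.

(** Let K(x, y) = f(x y^-1) (L x - L y) be the matrix of the commutator; by
hypothesis its norm is at most 1.  The matrix f(x y^-1) of lambda_f is
recovered from K by dividing by L x - L y, which is harmless where L x is much
larger than L y.  On the block {x | 2s <= L x} * {y | L y <= s} a geometric
series in L y / L x bounds the matrix of lambda_f by 1/s
([form_le_divide]).

The matrix of lambda_f is invariant under right translations, so a bound on a
single block A * B is a bound on all its right translates, and these can be
summed without loss: by Cauchy-Schwarz, the operator whose matrix is
f(x y^-1) #{z | xz in A, yz in B} is bounded by c #|A|^(1/2) #|B|^(1/2) when the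
matrix of lambda_f is bounded by c on A * B.  The weight depends on x y^-1 only, so this is the
convolution by the product of f with the function
u |-> #{b in B | ub in A} ([form_le_hit_count]).  Dividing by #|B|, the
function f may be multiplied by the proportion of b in B with ub in A, at the
cost of a factor that doubling keeps under control when A and B are contained
in balls of comparable radii ([form_le_hit_freq]).

This is used in two ways.  With A = {2s < L <= 16s} and B = {L <= s} the
proportion is 1 for 3s < L u <= 10s, and the result has norm O(1/s).  With
A = {L <= 4s} and B = {L <= s} the proportion is a cutoff phi_s, equal to 1 for
L u <= 3s and to 0 for L u > 5s, and multiplication of f by phi_s increases
norms by a bounded factor only.  Since phi_(2s) - phi_s lives on the annulus
3s < L u <= 10s, the norm of the convolution by (phi_(2s) - phi_s) f is O(1/s)
([annulus_form_le]).

Summing over s, 2s, 4s, ... shows that the convolution by (1 - phi_s) f has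
norm O(1/s) ([tail_form_le]); the sum is finite because f has finite support.
So f_flat = phi_s f, supported on the ball of radius 5s, does the job for s
large, and s depends only on eps and on the doubling constant.

Operator norms are handled through bilinear forms on finite blocks, in the
additive form |sum eta(x) K(x, y) xi(y)| <= c (|eta|^2 + |xi|^2), equivalent to
the bound 2c on the norm of the block.  Such estimates add up over the
translates, with max(#|A|, #|B|) in place of (#|A| #|B|)^(1/2); when #|A| is at
most a constant times #|B| this is as good. *)

Set Implicit Arguments.
Unset Strict Implicit.
Unset Printing Implicit Defensive.

Import Order.TTheory GRing.Theory Num.Theory.
Local Open Scope classical_set_scope.
Local Open Scope ring_scope.

(** * The modulus of a complex number *)

Section Complex.
Context (R : realType).
Implicit Types (z w : R[i]) (r : R).

Lemma normc_add z w : Normc.normc (z + w) <= Normc.normc z + Normc.normc w.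
Proof. exact: le_normcD. Qed.

Lemma normc_ge0 z : 0 <= Normc.normc z.
Proof. by case: z => a b; exact: sqrtr_ge0. Qed.

Lemma normc_real r : Normc.normc r%:C%C = `|r|.
Proof. by rewrite /Normc.normc /= expr0n addr0 sqrtr_sqr. Qed.

Lemma normc_sum (I : Type) (s : seq I) (P : pred I) (F : I -> R[i]) :
  Normc.normc (\sum_(i <- s | P i) F i) <= \sum_(i <- s | P i) Normc.normc (F i).
Proof.
elim/big_rec2: _ => [|i y z _ IH]; first by rewrite Normc.normc0.
by rewrite (le_trans (normc_add _ _))// lerD2l.
Qed.

Lemma mulr_conjc z : z * z^*%C = (Normc.normc z ^+ 2)%:C%C.
Proof.
by rewrite -sqr_normc normc_def rmorphXn; case: z.
Qed.

End Complex.

Lemma ex_pow2_ge (R : archiRealDomainType) (x : R) : exists n, x <= 2 ^+ n.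
Proof. by exists (Num.bound x); apply/ltW/upper_nthrootP. Qed.

(** * Matrix blocks and right translations *)

Lemma big_reindex_fset (T : choiceType) (V : nmodType) (h g : T -> T)
    (X A : {fset T}) (F : T -> V) : cancel h g -> cancel g h ->
  \sum_(x <- X | h x \in A) F x = \sum_(a <- A | g a \in X) F (g a).
Proof.
move=> hg gh; rewrite -big_filter -[RHS]big_filter -(big_map g xpredT F).
apply: perm_big; apply: uniq_perm.
- exact/filter_uniq/fset_uniq.
- by rewrite (map_inj_uniq (can_inj gh)) filter_uniq// fset_uniq.
- move=> x; rewrite mem_filter; apply/andP/mapP => [[hA xX]|[a]].
    by exists (h x); rewrite ?hg// mem_filter hg; apply/andP.
  by rewrite mem_filter => /andP[gX aA] ->; rewrite gh.
Qed.

Section Forms.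
Context (R : realType) (G : groupType).
Local Notation normc := (@Normc.normc R).
Implicit Types (f eta xi : G -> R[i]) (K : G -> G -> R[i]) (X Y A B : {fset G}).

Definition lambda_kernel f : G -> G -> R[i] := fun x y => f (x * y^-1)%g.

Definition sqnorm X xi : R := \sum_(x <- X) normc (xi x) ^+ 2.

Definition form K X Y eta xi : R[i] :=
  \sum_(x <- X) \sum_(y <- Y) eta x * K x y * xi y.

(** Equivalent to the bound [2 * c] on the operator norm of the block: after
rescaling, the sum of squares is twice the product of the norms of [eta] and
[xi]. *)
Definition form_le K X Y (c : R) : Prop := forall eta xi,
  normc (form K X Y eta xi) <= c * (sqnorm X eta + sqnorm Y xi).

Lemma sqnorm_ge0 X xi : 0 <= sqnorm X xi.
Proof. by apply: sumr_ge0 => x _; rewrite exprn_ge0// normc_ge0. Qed.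

Lemma form_le_ext K K' X Y c :
  {in X & Y, K =2 K'} -> form_le K X Y c -> form_le K' X Y c.
Proof.
move=> KK' Kc eta xi; suff <- : form K X Y eta xi = form K' X Y eta xi by [].
rewrite /form [LHS]big_seq [RHS]big_seq; apply: eq_bigr => x xX.
rewrite [LHS]big_seq [RHS]big_seq; apply: eq_bigr => y yY.
by rewrite KK'.
Qed.

Lemma form_le_mono K X Y c c' : c <= c' -> form_le K X Y c -> form_le K X Y c'.
Proof.
move=> cc' Kc eta xi; apply: le_trans (Kc eta xi) _.
by rewrite ler_wpM2r// addr_ge0// sqnorm_ge0.
Qed.

Lemma form_leD K K' X Y c c' : form_le K X Y c -> form_le K' X Y c' ->
  form_le (fun x y => K x y + K' x y) X Y (c + c').
Proof.
move=> Kc K'c eta xi; rewrite mulrDl.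
apply: (le_trans _ (lerD (Kc eta xi) (K'c eta xi))).
suff -> : form (fun x y => K x y + K' x y) X Y eta xi
    = form K X Y eta xi + form K' X Y eta xi by exact: normc_add.
rewrite /form -big_split/=; apply: eq_bigr => x _.
by rewrite -big_split/=; apply: eq_bigr => y _; rewrite mulrDr mulrDl.
Qed.

Lemma form_leZ K X Y c (t : R) : form_le K X Y c ->
  form_le (fun x y => t%:C%C * K x y) X Y (`|t| * c).
Proof.
move=> Kc eta xi; rewrite -mulrA -normc_real.
have -> : form (fun x y => t%:C%C * K x y) X Y eta xi
          = t%:C%C * form K X Y eta xi.
  rewrite /form mulr_sumr; apply: eq_bigr => x _.
  rewrite mulr_sumr; apply: eq_bigr => y _.
  by rewrite mulrCA !mulrA.
by rewrite Normc.normcM ler_wpM2l ?normc_ge0.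
Qed.

Definition hit_count A B (u : G) : R := \sum_(b <- B) ((u * b)%g \in A)%:R.

Definition translate X (z : G) xi : G -> R[i] :=
  fun a => if (a * z^-1)%g \in X then xi (a * z^-1)%g else 0.

(** A given [x] in [X] contributes to the translate by [z] only if [x * z]
is in [A], which happens for at most [#|` A|] of the [z]. *)
Lemma sum_sqnorm_translate (Z : {fset G}) A X xi :
  \sum_(z <- Z) sqnorm A (translate X z xi) <= #|` A|%:R * sqnorm X xi.
Proof.
have -> : \sum_(z <- Z) sqnorm A (translate X z xi) =
    \sum_(z <- Z) \sum_(x <- X | (x * z)%g \in A) normc (xi x) ^+ 2.
  apply: eq_bigr => z _.
  rewrite (big_reindex_fset _ _ _ (mulgK z) (mulgVK z)) [RHS]big_mkcond/=.
  apply: eq_bigr => a _; rewrite /translate; case: ifP => //.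
  by rewrite Normc.normc0 expr0n.
under eq_bigr do rewrite big_mkcond.
rewrite exchange_big/= /sqnorm mulr_sumr; apply: ler_sum => x _.
rewrite -big_mkcond/=.
rewrite (big_reindex_fset _ _ _ (mulKg x) (mulVKg x)).
rewrite big_mkcond -sum1_size natr_sum mulr_suml; apply: ler_sum => a _.
by case: ifP; rewrite ?mul1r// exprn_ge0// normc_ge0.
Qed.

(** Averaging over right translations: the form of the new kernel is the sum
over [z] of the forms of [f] on [A * B] at the translates by [z] of [eta] and
[xi], because [x * y^-1] does not change when [x] and [y] are both multiplied
by [z] on the right. *)
Lemma form_le_hit_count f A B X Y (c M : R) : 0 <= c ->
    #|` A|%:R <= M -> #|` B|%:R <= M ->
  form_le (lambda_kernel f) A B c ->
  form_le (lambda_kernel (fun u => (hit_count A B u)%:C%C * f u)) X Y (c * M).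
Proof.
move=> c0 AM BM fc eta xi.
(* all the translations that bring some point of Y into B *)
pose Z := [fset (p.1^-1 * p.2)%g | p in (Y `*` B)%fset]%fset.
have hit_countE x y : y \in Y -> hit_count A B (x * y^-1)%g =
    \sum_(z <- Z | (y * z)%g \in B) ((x * z)%g \in A)%:R.
  move=> yY; rewrite (big_reindex_fset _ _ _ (mulKg y) (mulVKg y)).
  rewrite /hit_count [LHS]big_seq_cond [RHS]big_seq_cond.
  apply: eq_big => [b|b]; last by rewrite mulgA.
  rewrite andbT; case: (boolP (b \in B)) => //= bB; apply/esym/imfsetP.
  by exists (y, b) => //=; rewrite in_fsetM yY.
have -> : form (lambda_kernel (fun u => (hit_count A B u)%:C%C * f u)) X Y eta xi =
    \sum_(z <- Z) form (lambda_kernel f) A B (translate X z eta) (translate Y z xi).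
  transitivity (\sum_(z <- Z) \sum_(x <- X | (x * z)%g \in A)
      \sum_(y <- Y | (y * z)%g \in B) eta x * lambda_kernel f x y * xi y).
    transitivity (\sum_(z <- Z) \sum_(x <- X) \sum_(y <- Y)
        (if (y * z)%g \in B then ((x * z)%g \in A)%:R%:C%C else 0)
          * (eta x * lambda_kernel f x y * xi y)); last first.
      apply: eq_bigr => z _; rewrite [RHS]big_mkcond/=; apply: eq_bigr => x _.
      case: ifP => _.
        rewrite [RHS]big_mkcond/=.
        by apply: eq_bigr => y _; case: ifP => _; rewrite ?mul1r ?mul0r.
      by rewrite big1// => y _; case: ifP => _; rewrite mul0r.
    rewrite exchange_big/=; apply: eq_bigr => x _.
    rewrite exchange_big/= [LHS]big_seq [RHS]big_seq; apply: eq_bigr => y yY.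
    rewrite -mulr_suml -big_mkcond/= -rmorph_sum /lambda_kernel hit_countE//=; ring.
  apply: eq_bigr => z _.
  rewrite (big_reindex_fset _ _ _ (mulgK z) (mulgVK z)) [LHS]big_mkcond/=.
  apply: eq_bigr => a _; rewrite /translate; case: ifP => aX; last first.
    by rewrite big1// => b _; rewrite !mul0r.
  rewrite (big_reindex_fset _ _ _ (mulgK z) (mulgVK z)) [LHS]big_mkcond/=.
  apply: eq_bigr => b _; case: ifP => bX; last by rewrite mulr0.
  by rewrite /lambda_kernel invgM invgK mulgA mulgVK.
apply: le_trans (normc_sum _ _ _) _.
apply: le_trans (ler_sum _ (fun z _ => fc _ _)) _.
rewrite -mulr_sumr -mulrA ler_wpM2l// big_split/= mulrDr.
by apply: lerD; apply: le_trans (sum_sqnorm_translate _ _ _ _) _;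
  rewrite ler_wpM2r// sqnorm_ge0.
Qed.

(** A crude bound, from which the iteration in [form_le_divide] starts. *)
Lemma form_le_entries K A B :
  form_le K A B (\sum_(x <- A) \sum_(y <- B) normc (K x y)).
Proof.
move=> eta xi; apply: le_trans (normc_sum _ _ _) _.
rewrite mulr_suml big_seq [leRHS]big_seq; apply: ler_sum => x xA.
apply: le_trans (normc_sum _ _ _) _.
rewrite mulr_suml big_seq [leRHS]big_seq; apply: ler_sum => y yB.
rewrite !Normc.normcM mulrAC mulrC ler_wpM2l ?normc_ge0//.
have le_sqnorm X (z : G) (zeta : G -> R[i]) : z \in X ->
    normc (zeta z) ^+ 2 <= sqnorm X zeta.
  move=> zX; rewrite /sqnorm (big_fsetD1 z)//= lerDl sumr_ge0// => ? _.
  by rewrite exprn_ge0// normc_ge0.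
apply: le_trans (lerD (le_sqnorm _ _ eta xA) (le_sqnorm _ _ xi yB)).
move: (normc (eta x)) (normc (xi y)) => u v; nra.
Qed.

(** The identity 1 = (L x - L y) / L x + L y / L x expresses the block of [f]
by that of the commutator and by itself, the latter with a factor
[L y / L x <= 1 / 2]. *)
Lemma form_le_divide_step f (L : G -> R) A B (s c C : R) : 0 < s -> 0 <= c -> 0 <= C ->
    {in A, forall x, 2 * s <= L x} -> {in B, forall y, 0 <= L y <= s} ->
  form_le (fun x y => f (x * y^-1)%g * (L x - L y)%:C%C) A B c ->
  form_le (lambda_kernel f) A B C ->
  form_le (lambda_kernel f) A B ((c / s + C) / 2).
Proof.
move=> s0 c0 C0 LA LB Kc fC eta xi.
have L0 x : x \in A -> L x != 0.
  by move=> /LA Lx; rewrite gt_eqF// (lt_le_trans _ Lx)// mulr_gt0.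
pose eta' x := (2 * s / L x)%:C%C * eta x.
pose xi' x := (L x / s)%:C%C * xi x.
have eta'le : sqnorm A eta' <= sqnorm A eta.
  rewrite /sqnorm !big_seq; apply: ler_sum => x /LA xA.
  have Lx : 0 < L x by rewrite (lt_le_trans _ xA)// mulr_gt0.
  rewrite Normc.normcM normc_real exprMn ler_piMl ?exprn_ge0 ?normc_ge0//.
  rewrite real_normK ?num_real// expr_le1// ?divr_ge0 ?ler_pdivrMr ?mul1r//.
    by rewrite mulr_ge0// ltW.
  exact: ltW.
have xi'le : sqnorm B xi' <= sqnorm B xi.
  rewrite /sqnorm !big_seq; apply: ler_sum => x /LB/andP[Lx0 Lx].
  rewrite Normc.normcM normc_real exprMn ler_piMl ?exprn_ge0 ?normc_ge0//.
  rewrite real_normK ?num_real// expr_le1// ?divr_ge0 ?ler_pdivrMr ?mul1r//.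
  exact: ltW.
(* The test vectors eta' and xi' absorb the factors 1 / L x and L y, scaled by
   2 * s and 1 / s so that the norms do not grow. *)
have -> : form (lambda_kernel f) A B eta xi =
    (2 * s)^-1%:C%C * form (fun x y => f (x * y^-1)%g * (L x - L y)%:C%C) A B eta' xi
    + (2^-1)%:C%C * form (lambda_kernel f) A B eta' xi'.
  rewrite /form !mulr_sumr -big_split/= [LHS]big_seq [RHS]big_seq.
  apply: eq_bigr => x xA; rewrite !mulr_sumr -big_split/=.
  apply: eq_bigr => y _; rewrite /eta' /xi' /lambda_kernel.
  rewrite rmorphB !rmorphM !fmorphV/= !rmorphM/=.
  have Lx0 : (L x)%:C%C != 0 :> R[i] by rewrite fmorph_eq0 L0.
  have ss0 : s%:C%C != 0 :> R[i] by rewrite fmorph_eq0 gt_eqF.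
  have -> : 2%:C%C = 2 :> R[i] by rewrite rmorph_nat.
  move: (f _) (eta x) (xi y) (L y)%:C%C (L x)%:C%C s%:C%C Lx0 ss0.
  by move=> u v w p q t q0 t0; field; rewrite q0 t0.
apply: le_trans (normc_add _ _) _; rewrite !Normc.normcM !normc_real.
have h1 := Kc eta' xi; have h2 := fC eta' xi'.
have s1 : 0 < s^-1 by rewrite invr_gt0.
rewrite !ger0_norm ?invr_ge0 ?mulr_ge0 ?(ltW s0)// invfM.
have h1' : s^-1 * normc (form (fun x y => f (x * y^-1)%g * (L x - L y)%:C%C)
    A B eta' xi) <= s^-1 * (c * (sqnorm A eta + sqnorm B xi)).
  by rewrite ler_pM2l//; apply: le_trans h1 _; rewrite ler_wpM2l// lerD2r.
have h2' : normc (form (lambda_kernel f) A B eta' xi')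
    <= C * (sqnorm A eta + sqnorm B xi).
  by apply: le_trans h2 _; rewrite ler_wpM2l// lerD.
lra.
Qed.

(** The map [C |-> (c / s + C) / 2] of the previous lemma is a contraction with
fixed point [c / s]. *)
Lemma form_le_divide f (L : G -> R) A B (s c : R) : 0 < s -> 0 <= c ->
    {in A, forall x, 2 * s <= L x} -> {in B, forall y, 0 <= L y <= s} ->
  form_le (fun x y => f (x * y^-1)%g * (L x - L y)%:C%C) A B c ->
  form_le (lambda_kernel f) A B (c / s).
Proof.
move=> s0 c0 LA LB Kc.
set C0 := \sum_(x <- A) \sum_(y <- B) normc (lambda_kernel f x y).
have C00 : 0 <= C0 by do 2![apply: sumr_ge0 => ? _]; exact: normc_ge0.
have iter n : form_le (lambda_kernel f) A B (c / s + C0 / 2 ^+ n).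
  elim: n => [|n IH]; last first.
    have -> : c / s + C0 / 2 ^+ n.+1 = (c / s + (c / s + C0 / 2 ^+ n)) / 2.
      by rewrite exprS; field; rewrite expf_neq0 ?gt_eqF.
    apply: (form_le_divide_step s0 c0 _ LA LB Kc IH).
    by rewrite addr_ge0// divr_ge0// ?exprn_ge0// ltW.
  rewrite expr0 divr1.
  apply: (@form_le_mono _ _ _ C0); first by rewrite lerDr divr_ge0// ltW.
  exact: form_le_entries.
move=> eta xi; apply/ler_addgt0Pr => e e0.
set N := sqnorm A eta + sqnorm B xi.
have N0 : 0 <= N by rewrite addr_ge0// sqnorm_ge0.
have [n hn] := ex_pow2_ge (C0 * N / e).
apply: le_trans (iter n eta xi) _; rewrite mulrDl lerD2l mulrAC.
by rewrite ler_pdivrMr ?exprn_gt0// [e * _]mulrC -ler_pdivrMr.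
Qed.

Definition hit_freq A B (u : G) : R := hit_count A B u / #|` B|%:R.

Lemma form_le_hit_freq f A B X Y (c M : R) : 0 <= c -> B != fset0 -> 1 <= M ->
    #|` A|%:R <= M * #|` B|%:R ->
  form_le (lambda_kernel f) A B c ->
  form_le (lambda_kernel (fun u => (hit_freq A B u)%:C%C * f u)) X Y (c * M).
Proof.
move=> c0; rewrite -cardfs_gt0 -(ltr0n R) => B0 M1 AM fc.
have -> : c * M = `|#|` B|%:R^-1| * (c * (M * #|` B|%:R)).
  by rewrite ger0_norm ?invr_ge0 ?ler0n//; field; rewrite gt_eqF.
have := form_leZ #|` B|%:R^-1 (form_le_hit_count X Y c0 AM (ler_peMl (ltW B0) M1) fc).
by apply: form_le_ext => x y _ _; rewrite /lambda_kernel /hit_freq rmorphM/= mulrC mulrAC mulrC.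
Qed.

Lemma hit_freq1 A B u : B != fset0 -> {in B, forall b, (u * b)%g \in A} ->
  hit_freq A B u = 1.
Proof.
rewrite -cardfs_gt0 -(ltr0n R) => B0 uB.
rewrite /hit_freq /hit_count (eq_big_seq (fun=> 1%N%:R)); last by move=> b /uB ->.
by rewrite -natr_sum sum1_size divff// gt_eqF.
Qed.

Lemma hit_freq0 A B u : {in B, forall b, (u * b)%g \notin A} -> hit_freq A B u = 0.
Proof.
move=> uB; rewrite /hit_freq /hit_count (eq_big_seq (fun=> 0)) ?big1 ?mul0r//.
by move=> b /uB/negbTE ->.
Qed.

End Forms.

(** * Operators on square summable functions and finite blocks *)

Section Operators.
Context (R : realType) (G : groupType).
Local Notation normc := (@Normc.normc R).
Implicit Types (f g eta xi : G -> R[i]) (L : G -> R) (X Y : {fset G}).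

Lemma l2norm_leP xi (r : R) : 0 <= r ->
  (l2norm xi <= r%:E)%E <-> forall X, sqnorm X xi <= r ^+ 2.
Proof.
move=> r0; have -> : r%:E = sqrte (r ^+ 2)%:E.
  by rewrite /= sqrtr_sqr ger0_norm.
rewrite /l2norm lee_sqrt ?lee_fin ?sqr_ge0//; split => [h X|h].
  rewrite -lee_fin; apply: le_trans h; apply: ereal_sup_ubound.
  exists [set` X]; first by split => //; exact: finite_fset.
  by rewrite fsbig_finite ?finite_fset// set_fsetK sumEFin.
apply: ge_ereal_sup => _ [A [finA _] <-].
by rewrite fsbig_finite// sumEFin lee_fin; exact: h.
Qed.

Lemma fsum_fset Y (F : G -> R[i]) : (forall y, y \notin Y -> F y = 0) ->
  \sum_(y \in [set: G]) F y = \sum_(y <- Y) F y.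
Proof.
move=> F0; rewrite -(@fsbig_widen _ _ _ _ [set` Y])//.
  by rewrite fsbig_finite ?finite_fset// set_fsetK.
by move=> y [_ /= /negP]; exact: F0.
Qed.

Lemma sqnorm_supp X Y xi : (forall y, y \notin Y -> xi y = 0) ->
  sqnorm X xi <= sqnorm Y xi.
Proof.
move=> xi0; rewrite /sqnorm.
have -> : \sum_(x <- X) normc (xi x) ^+ 2 =
    \sum_(x <- X | id x \in Y) normc (xi x) ^+ 2.
  rewrite [RHS]big_mkcond; apply: eq_bigr => x _; case: ifPn => // /xi0 ->.
  by rewrite Normc.normc0 expr0n.
rewrite (big_reindex_fset _ _ _ (frefl id) (frefl id)) big_mkcond.
apply: ler_sum => x _; case: ifP => // _.
by rewrite exprn_ge0// normc_ge0.
Qed.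

Lemma commutatorE L f Y xi x : (forall y, y \notin Y -> xi y = 0) ->
  commutator L f xi x
    = \sum_(y <- Y) f (x * y^-1)%g * (L x - L y)%:C%C * xi y.
Proof.
move=> xi0; rewrite /commutator /Dirac /lambda.
rewrite !(@fsum_fset Y) => [|y /xi0 ->|y /xi0 ->]; rewrite ?mulr0//.
rewrite mulr_sumr -sumrB; apply: eq_bigr => y _.
by rewrite rmorphB/=; ring.
Qed.

(** Test vectors are cut to [Y] and have finite support, hence lie in the
domain of the commutator. *)
Lemma commutator_form_le L f X Y : (commutator_norm L f <= 1)%E ->
  form_le (fun x y => f (x * y^-1)%g * (L x - L y)%:C%C) X Y 2^-1.
Proof.
move=> Lf1 eta xi.
pose cut y := if y \in Y then xi y else 0.
have sqcut : sqnorm Y cut = sqnorm Y xi.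
  by apply: eq_big_seq => y yY; rewrite /cut yY.
have comm_le : sqnorm X (commutator L f cut) <= sqnorm Y xi.
  (* e avoids the division by zero when xi vanishes on Y *)
  apply/ler_addgt0Pr => e e0.
  have N0 : 0 < sqnorm Y xi + e by rewrite ltr_wpDl// sqnorm_ge0.
  pose t := (Num.sqrt (sqnorm Y xi + e))^-1.
  have t0 : 0 < t by rewrite invr_gt0 sqrtr_gt0.
  have tE : t ^+ 2 = (sqnorm Y xi + e)^-1.
    by rewrite exprVn sqr_sqrtr// ltW.
  pose xi' y := t%:C%C * cut y.
  have sqZ (Z : {fset G}) zeta :
      sqnorm Z (fun y => t%:C%C * zeta y) = t ^+ 2 * sqnorm Z zeta.
    rewrite /sqnorm mulr_sumr; apply: eq_bigr => z _.
    by rewrite Normc.normcM exprMn normc_real real_normK ?num_real.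
  have xi'0 y : y \notin Y -> xi' y = 0.
    by rewrite /xi' /cut => /negbTE ->; rewrite mulr0.
  have xi'1 : (l2norm xi' <= 1)%E.
    apply/(l2norm_leP _ ler01) => Z; apply: le_trans (sqnorm_supp _ xi'0) _.
    by rewrite sqZ sqcut tE expr1n ler_pdivrMl// mulr1 lerDl ltW.
  have l2xi' : Dirac_dom L xi'.
    split; first exact: le_lt_trans xi'1 (ltry _).
    have Dxi0 y : y \notin Y -> Dirac L xi' y = 0.
      by move=> /xi'0 xi'y; rewrite /Dirac xi'y mulr0.
    apply: (@le_lt_trans _ _ (Num.sqrt (sqnorm Y (Dirac L xi')))%:E _ _ _ (ltry _)).
    apply/l2norm_leP => // Z; rewrite sqr_sqrtr ?sqnorm_ge0//.
    exact: sqnorm_supp.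
  have : (l2norm (commutator L f xi') <= 1)%E.
    by apply: le_trans Lf1; apply: ereal_sup_ubound; exists xi'.
  move=> /(l2norm_leP _ ler01)/(_ X).
  have -> : commutator L f xi' = (fun x => t%:C%C * commutator L f cut x).
    apply/funext => x; rewrite (commutatorE _ _ _ xi'0) (@commutatorE _ _ Y).
      by rewrite mulr_sumr; apply: eq_bigr => y _; rewrite mulrCA.
    by move=> y; rewrite /cut => /negbTE ->.
  by rewrite sqZ tE expr1n ler_pdivrMl// mulr1.
have -> : form (fun x y => f (x * y^-1)%g * (L x - L y)%:C%C) X Y eta xi =
    \sum_(x <- X) eta x * commutator L f cut x.
  apply: eq_bigr => x _; rewrite (@commutatorE _ _ Y); last first.
    by move=> y; rewrite /cut => /negbTE ->.
  rewrite mulr_sumr; apply: eq_big_seq => y yY.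
  by rewrite /cut yY !mulrA.
apply: le_trans (normc_sum _ _ _) _.
apply: (@le_trans _ _ (2^-1 * (sqnorm X eta + sqnorm X (commutator L f cut)))).
  rewrite -big_split/= mulr_sumr; apply: ler_sum => x _; rewrite Normc.normcM.
  by move: (normc _) (normc _) => u v; have := sqr_ge0 (u - v); lra.
by rewrite ler_wpM2l// ?invr_ge0// lerD2l.
Qed.

(** Since [g] has finite support, the values of [lambda g xi] on [X] depend
only on those of [xi] on a finite set [Y].  Testing against a multiple [eta] of
the conjugate of [lambda g xi] then turns the bounds on blocks into a bound on
vectors. *)
Lemma lambda_norm_le g (e : R) : 0 < e -> finite_set (supp g) ->
  (forall X Y, form_le (lambda_kernel g) X Y (e / 2)) -> (lambda_norm g <= e%:E)%E.
Proof.
move=> e0 fing ge; apply: ge_ereal_sup => _ [xi [_ /= xi1] <-].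
move: xi1 => /(l2norm_leP _ ler01) xi1.
apply/(l2norm_leP _ (ltW e0)) => X.
pose Y := [fset (p.2^-1 * p.1)%g | p in (X `*` fset_set (supp g))%fset]%fset.
have lambdaE x : x \in X ->
    lambda g xi x = \sum_(y <- Y) g (x * y^-1)%g * xi y.
  move=> xX; apply: fsum_fset => y; apply: contraNeq => gxy.
  apply/imfsetP; exists (x, (x * y^-1)%g); last by rewrite /= invgM invgK mulgVK.
  rewrite /= in_fsetM xX in_fset_set//= inE /supp/=.
  by apply: contraNneq gxy => ->; rewrite mul0r.
(* The factor 1 / e is optimal: it makes eta of norm 1 when lambda g xi has
   norm e. *)
pose eta x := e^-1%:C%C * (lambda g xi x)^*%C.
have normc_conj (z : R[i]) : normc z^*%C = normc z.
  by case: z => a b /=; rewrite sqrrN.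
have etaE : sqnorm X eta = e ^- 2 * sqnorm X (lambda g xi).
  rewrite /sqnorm mulr_sumr; apply: eq_bigr => x _.
  by rewrite Normc.normcM exprMn normc_real real_normK ?num_real// normc_conj exprVn.
have formE : form (lambda_kernel g) X Y eta xi = (e^-1 * sqnorm X (lambda g xi))%:C%C.
  rewrite /form /sqnorm rmorphM rmorph_sum mulr_sumr.
  apply: eq_big_seq => x xX; under eq_bigr do rewrite -mulrA.
  rewrite -mulr_sumr -lambdaE// /eta -mulrA [_^*%C * _]mulrC mulr_conjc.
  by [].
have := ge X Y eta xi; rewrite formE etaE normc_real ger0_norm; last first.
  by rewrite mulr_ge0 ?sqnorm_ge0// invr_ge0 ltW.
have := xi1 Y; rewrite expr1n; move: (sqnorm X _) (sqnorm Y _) => S N N1 SN.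
have : e^-1 * S <= e / 2 * (e ^- 2 * S + 1).
  by apply: le_trans SN _; rewrite ler_wpM2l ?divr_ge0 ?lerD2l// ltW.
have -> : e / 2 * (e ^- 2 * S + 1) = e^-1 * S / 2 + e / 2.
  by field; rewrite gt_eqF.
move=> h; have : e^-1 * S <= e by lra.
by rewrite ler_pdivrMl.
Qed.

End Operators.

(** * Cutoffs at the scales of a doubling length *)

Section Balls.
Context (R : realType) (G : groupType) (L : G -> R).
Hypotheses (L_length : is_length L)
  (finB : forall r, finite_set (length_ball L r)).
Implicit Types (f : G -> R[i]) (X Y : {fset G}).

Definition fball r : {fset G} := fset_set (length_ball L r).

Lemma in_fball r x : (x \in fball r) = (L x <= r).
Proof. by rewrite in_fset_set//; apply/idP/idP; rewrite inE. Qed.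

Lemma fball_neq0 r : 0 <= r -> fball r != fset0.
Proof.
move=> r0; apply/fset0Pn; exists 1%g.
by rewrite in_fball ((length_eq0 L_length _).2 erefl).
Qed.

Lemma length_mul_ge x y : L x - L y <= L (x * y)%g.
Proof.
rewrite lerBlDr -[in leLHS](mulgK y x) -(length_inv L_length y).
exact: length_mul.
Qed.

Definition cutoff s : G -> R := hit_freq R (fball (4 * s)) (fball s).

Lemma cutoff1 s x : 0 <= s -> L x <= 3 * s -> cutoff s x = 1.
Proof.
move=> s0 xs; apply: hit_freq1 => [|b]; first exact: fball_neq0.
rewrite !in_fball => bs; have := length_mul L_length x b; lra.
Qed.

Lemma cutoff0 s x : 5 * s < L x -> cutoff s x = 0.
Proof.
move=> xs; apply: hit_freq0 => b.
rewrite !in_fball -ltNge => bs; have := length_mul_ge x b; lra.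
Qed.

Variable C : R.
Hypotheses (C1 : 1 <= C) (doubling : forall r, 1 <= r ->
  #|` fball (2 * r)|%:R <= C * #|` fball r|%:R).

Lemma card_fball_pow2 k r : 1 <= r ->
  #|` fball (2 ^+ k * r)|%:R <= C ^+ k * #|` fball r|%:R.
Proof.
move=> r1; elim: k => [|k IH]; first by rewrite !expr0 !mul1r.
rewrite !exprS -!mulrA; apply: le_trans (doubling _) _.
  by rewrite mulr_ege1// exprn_ege1// ler1n.
by rewrite ler_wpM2l// (le_trans ler01 C1).
Qed.

(** The difference of the two cutoffs lives on [3 * s < L u <= 10 * s].  There
[f] equals the function [g] below, whose norm is controlled because [g] arises
by averaging from a block on which [L x - L y] is at least [s]. *)
Lemma annulus_form_le f s X Y : 1 <= s -> (commutator_norm L f <= 1)%E ->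
  form_le (lambda_kernel (fun u => (cutoff (2 * s) u - cutoff s u)%:C%C * f u)) X Y
    (C ^+ 6 / s).
Proof.
move=> s1 Lf; have s0 : 0 < s by rewrite (lt_le_trans ltr01 s1).
pose A := [fset x in fball (2 ^+ 4 * s) | 2 * s < L x]%fset.
have Aball : #|` A|%:R <= C ^+ 4 * #|` fball s|%:R.
  apply: le_trans (card_fball_pow2 4 s1); rewrite ler_nat fsubset_leq_card//.
  exact: fset_sub.
pose g u := (hit_freq R A (fball s) u)%:C%C * f u.
have gX Z W : form_le (lambda_kernel g) Z W (2^-1 / s * C ^+ 4).
  apply: form_le_hit_freq => //.
  - by rewrite divr_ge0// ?invr_ge0// ltW.
  - by rewrite fball_neq0// ltW.
  - exact: exprn_ege1.
  apply: (form_le_divide s0 _ _ _ (commutator_form_le _ _ Lf)).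
  - by rewrite invr_ge0.
  - by move=> x; rewrite !inE => /andP[_ /ltW].
  - by move=> y; rewrite in_fball (length_ge0 L_length).
have cutX t : 1 <= t ->
    form_le (lambda_kernel (fun u => (cutoff t u)%:C%C * g u)) X Y
      (2^-1 / s * C ^+ 4 * C ^+ 2).
  move=> t1; apply: form_le_hit_freq => //.
  - by rewrite mulr_ge0 ?divr_ge0 ?invr_ge0 ?exprn_ge0// ?ltW// (lt_le_trans ltr01).
  - by rewrite fball_neq0// (le_trans ler01).
  - exact: exprn_ege1.
  by have := card_fball_pow2 2 t1; rewrite -natrX.
have -> : C ^+ 6 / s =
    2^-1 / s * C ^+ 4 * C ^+ 2 + `|-1| * (2^-1 / s * C ^+ 4 * C ^+ 2).
  by rewrite normrN1 mul1r; field; rewrite gt_eqF.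
have s2 : 1 <= 2 * s by lra.
have := form_leD (cutX _ s2) (form_leZ (-1) (cutX _ s1)).
apply: form_le_ext => x y _ _; rewrite /lambda_kernel; set u := (x * y^-1)%g.
rewrite rmorphB/= rmorphN1 mulN1r -mulrBl /g.
have [us|us] := leP (L u) (3 * s).
  rewrite !cutoff1 ?subrr ?mul0r//; lra.
have [us'|us'] := ltP (5 * (2 * s)) (L u).
  rewrite !cutoff0 ?subrr ?mul0r//; lra.
rewrite hit_freq1 ?mul1r ?fball_neq0 ?ltW//.
move=> b; rewrite in_fball => bs; rewrite !inE in_fball.
have := length_mul L_length u b; have := length_mul_ge u b; lra.
Qed.

(** The bounds on the annuli at scales [s], [2 * s], [4 * s]... form a geometric
series, so that the total is independent of [n]. *)
Lemma tail_form_le f s n X Y : 1 <= s -> (commutator_norm L f <= 1)%E ->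
  form_le (lambda_kernel (fun u => (cutoff (2 ^+ n * s) u - cutoff s u)%:C%C * f u)) X Y
    (2 * C ^+ 6 / s).
Proof.
move=> s1 Lf; have s0 : 0 < s by rewrite (lt_le_trans ltr01 s1).
apply: (@form_le_mono _ _ _ _ _ (2 * C ^+ 6 / s * (1 - 2 ^- n))).
  rewrite ler_piMr ?gerBl ?invr_ge0 ?exprn_ge0//.
  by rewrite divr_ge0 ?mulr_ge0 ?exprn_ge0 ?(le_trans ler01 C1)// ltW.
elim: n => [|n IH].
  move=> eta xi; rewrite expr0 invr1 subrr mulr0 mul0r.
  rewrite /form big1 ?Normc.normc0// => x _; rewrite big1// => y _.
  by rewrite /lambda_kernel mul1r subrr mul0r mulr0 mul0r.
have ns1 : 1 <= 2 ^+ n * s.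
  by rewrite mulr_ege1// exprn_ege1// ler1n.
have -> : 2 * C ^+ 6 / s * (1 - 2 ^- n.+1) =
    C ^+ 6 / (2 ^+ n * s) + 2 * C ^+ 6 / s * (1 - 2 ^- n).
  by rewrite (exprS _ n); field; rewrite expf_neq0 ?gt_eqF.
have := form_leD (annulus_form_le X Y ns1 Lf) IH.
apply: form_le_ext => x y _ _; rewrite /lambda_kernel -mulrDl -rmorphD/= mulrA -exprS.
by congr (_%:C%C * _); lra.
Qed.

End Balls.

Theorem proposition1p6 (R : realType) (G : groupType) (L : G -> R)
    (L_length : is_length L) (L_doubling : bounded_doubling L)
    (eps : R) (eps_gt0 : 0 < eps) :
  exists S : set G, finite_set S /\
    forall f : G -> R[i], finite_set (supp f) ->
      (commutator_norm L f <= 1)%E ->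
      exists fsharp fflat : G -> R[i],
        [/\ forall x, f x = fsharp x + fflat x,
            supp fflat `<=` S
          & (lambda_norm fsharp <= eps%:E)%E].
Proof.
have [finB [C0 dbl0]] := L_doubling.
pose C := Num.max C0 1.
have C1 : 1 <= C by rewrite le_max lexx orbT.
have dbl r : 1 <= r -> #|` fball L (2 * r)|%:R <= C * #|` fball L r|%:R.
  by move=> r1; apply: le_trans (dbl0 r r1) _; rewrite ler_wpM2r// le_max lexx.
have [J hJ] := ex_pow2_ge (4 * C ^+ 6 / eps).
pose s : R := 2 ^+ J.
have s1 : 1 <= s by rewrite exprn_ege1// ler1n.
have s0 : 0 < s by rewrite (lt_le_trans ltr01 s1).
exists (length_ball L (5 * s)); split => // f finf Lf.
pose fflat u := (cutoff L s u)%:C%C * f u.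
exists (fun u => f u - fflat u), fflat; split.
- by move=> x; rewrite subrK.
- move=> x /= ; apply: contraNle => xs.
  by rewrite /fflat cutoff0// mul0r.
apply: lambda_norm_le => //.
  apply: sub_finite_set finf => x /=; apply: contraNneq => fx.
  by rewrite /fflat fx mulr0 subrr.
move=> X Y.
pose F := fset_set (supp f).
(* at scale 2 ^+ n * s the cutoff is 1 on the support of f *)
have [n hn] := ex_pow2_ge (\sum_(x <- F) L x).
have c_le : 2 * C ^+ 6 / s <= eps / 2.
  rewrite ler_pdivrMr// mulrAC ler_pdivlMr//.
  by move: hJ; rewrite ler_pdivrMr// -/s; lra.
apply: (form_le_mono c_le).
have := tail_form_le L_length finB C1 dbl n X Y s1 Lf.
apply: form_le_ext => x y _ _; rewrite /lambda_kernel /fflat; set u := (x * y^-1)%g.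
have [->|fu] := eqVneq (f u) 0; first by rewrite !mulr0 subrr.
rewrite (cutoff1 L_length finB (s := 2 ^+ n * s)).
- by rewrite rmorphB/= mulrBl mul1r.
- by rewrite mulr_ge0 ?exprn_ge0 ?(ltW s0).
apply: (@le_trans _ _ (\sum_(x <- F) L x)).
  have uF : u \in F by rewrite in_fset_set// inE.
  rewrite (big_fsetD1 u)//= lerDl sumr_ge0// => z _; exact: length_ge0.
apply: le_trans hn _; rewrite mulrCA ler_peMr ?exprn_ge0//; lra.
Qed.
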